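(* For every integer $n \geq 2$, \[|\mathrm{ParseWords}(\mathrm{LeftCrookedTree}(n), \mathrm{RightCrookedTree}(n))| = 2^{\lfloor n/2 \rfloor - 1}.\]
   Context: A binary tree is a rooted ordered tree in which each vertex has either $0$ or $2$ children; its leaves are ordered left to right. Let $G$ be the context-free grammar with start symbols $0,1,2$ and rules $0\to 12$, $0\to 21$, $1\to 02$, $1\to 20$, $2\to 01$, $2\to 10$. An $n$-leaf binary tree $T$ parses a word $w$ of length $n$ on $\{0,1,2\}$ if there is a labeling of the vertices of $T$ by $0,1,2$ such that the leaves, from left to right, are labeled with the letters of $w$, and at every internal vertex the label of the vertex together with the labels of its left and right children form a rule of $G$ (i.e. the three labels are pairwise distinct). If $T$ parses $w$, it also parses every word obtained from $w$ by permuting the alphabet $\{0,1,2\}$. For $n$-leaf binary trees $T_1,T_2$, $\mathrm{ParseWords}(T_1,T_2)$ denotes the set of equivalence classes (under permutations of the alphabet $\{0,1,2\}$) of words parsed by both $T_1$ and $T_2$. The level of a vertex is its distance from the root. A path tree is a binary tree with at most two vertices on each level. For $n\ge 2$, $n$-leaf path trees correspond bijectively to words $x_1\cdots x_{n-2}$ on $\{l,r\}$: $x_j=l$ (resp. $x_j=r$) means that, of the two vertices on level $j$, the left (resp. right) one has children. $\mathrm{LeftCrookedTree}(n)$ is the $n$-leaf path tree corresponding to the alternating word $lrlr\cdots$ of length $n-2$ (starting with $l$), and $\mathrm{RightCrookedTree}(n)$ is the one corresponding to the alternating word $rlrl\cdots$ of length $n-2$ (starting with $r$). *)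

(* Defs.v *)
From mathcomp Require Import all_boot perm zify.
(* Only for [`[< P >]], which turns a Prop into a bool. *)
From mathcomp Require Import boolp.

Set Implicit Arguments.
Unset Strict Implicit.
Unset Printing Implicit Defensive.

Inductive bintree : Type :=
| Leaf
| Node (T1 T2 : bintree).

Fixpoint nleaves (T : bintree) : nat :=
  if T is Node T1 T2 then nleaves T1 + nleaves T2 else 1.

Notation letter := 'I_3.

(* [rule a b c] is the production a -> b c. *)
Definition rule (a b c : letter) : bool :=
  (nat_of_ord a, nat_of_ord b, nat_of_ord c) \in
    [:: (0, 1, 2); (0, 2, 1); (1, 0, 2); (1, 2, 0); (2, 0, 1); (2, 1, 0)].

Lemma ruleE a b c : rule a b c = uniq [:: a; b; c].
Proof.
by case: a => [[|[|[|?]]]] //; case: b => [[|[|[|?]]]] //;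
  case: c => [[|[|[|?]]]].
Qed.

(* A labeling of T is an [ltree] t such that [shape t = T]. *)
Inductive ltree : Type :=
| LLeaf (a : letter)
| LNode (a : letter) (t1 t2 : ltree).

Fixpoint shape (t : ltree) : bintree :=
  if t is LNode _ t1 t2 then Node (shape t1) (shape t2) else Leaf.

Definition root_label (t : ltree) : letter :=
  match t with LLeaf a => a | LNode a _ _ => a end.

Fixpoint yield (t : ltree) : seq letter :=
  match t with
  | LLeaf a => [:: a]
  | LNode _ t1 t2 => yield t1 ++ yield t2
  end.

Fixpoint valid (t : ltree) : bool :=
  if t is LNode a t1 t2 then
    [&& rule a (root_label t1) (root_label t2), valid t1 & valid t2]
  else true.

Definition parses (T : bintree) (w : seq letter) : Prop :=
  exists t : ltree, [/\ shape t = T, yield t = w & valid t].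

Lemma parses_size T w : parses T w -> size w = nleaves T.
Proof.
case=> t [<- <- _]; elim: t => //= _ t1 IH1 t2 IH2.
by rewrite size_cat IH1 IH2.
Qed.

Definition word_class n (w : n.-tuple letter) : {set n.-tuple letter} :=
  [set map_tuple s w | s : {perm letter}].

Definition ParseWords n (T1 T2 : bintree) : {set {set n.-tuple letter}} :=
  [set word_class w | w in
     [set w : n.-tuple letter | `[< parses T1 w /\ parses T2 w >]]].

(* [level T k] lists the vertices on level k of T from left to right, each
   given as the subtree rooted there. *)
Fixpoint level (T : bintree) (k : nat) {struct k} : seq bintree :=
  match k, T with
  | 0, _ => [:: T]
  | k'.+1, Leaf => [::]
  | k'.+1, Node T1 T2 => level T1 k' ++ level T2 k'
  end.

Definition is_path_tree (T : bintree) : Prop :=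
  forall k, size (level T k) <= 2.

Definition has_children (T : bintree) : bool :=
  if T is Node _ _ then true else false.

Inductive dir : Type := Lft | Rgt.

Definition flip (d : dir) : dir := if d is Lft then Rgt else Lft.

(* The word x_1 ... x_(n-2) is a 0-indexed sequence, so its j-th item describes
   level j.+1. *)
Definition encodes (x : seq dir) (T : bintree) : Prop :=
  [/\ is_path_tree T, nleaves T = (size x).+2 &
      forall j, j < size x ->
        map has_children (level T j.+1) =
          if nth Lft x j is Lft then [:: true; false] else [:: false; true]].

Fixpoint path_tree (x : seq dir) : bintree :=
  match x with
  | [::] => Node Leaf Leaf
  | Lft :: x' => Node (path_tree x') Leaf
  | Rgt :: x' => Node Leaf (path_tree x')
  end.

Lemma nleaves_gt0 T : 0 < nleaves T.
Proof. by elim: T => //= T1 IH1 T2 IH2; rewrite addn_gt0 IH1. Qed.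

Lemma level_Leaf k : level Leaf k.+1 = [::].
Proof. by []. Qed.

Lemma path_tree_encodes x : encodes x (path_tree x).
Proof.
elim: x => [|d x [pT lT cT]].
  by split=> // k; case: k => [|[|[|k]]].
have hc : has_children (path_tree x) by case: (x) => [|[] ?].
split.
- move=> k; case: k => [|[|k]]; first by [].
    by case: d.
  case: d => /=.
  + by rewrite cats0; exact: (pT k.+1).
  + exact: (pT k.+1).
- by case: d => /=; rewrite lT ?addn1.
- case=> [_|j hj]; first by case: d => /=; rewrite hc.
  have := cT j hj; case: d {hj} => /= <- //.
  by rewrite cats0.
Qed.

Lemma encodes_inj x T : encodes x T -> T = path_tree x.
Proof.
elim: x T => [|d x IH] [|T1 T2] [pT lT cT] //.
  case: T1 T2 lT {pT cT} => [|A B] [|C D] //=;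
    have := nleaves_gt0; move=> h.
  + by have := h C; have := h D; lia.
  + by have := h A; have := h B; lia.
  + by have := h A; have := h B; have := h C; have := h D; lia.
have := cT 0 isT; case: d cT lT => cT lT /=.
- case: T2 pT cT lT => [|//] pT cT lT _; congr Node; apply: IH; split.
  + by move=> k; case: k => // k; have := pT k.+2; rewrite /= cats0.
  + by move: lT => /=; lia.
  + by move=> j hj; have := cT j.+1 hj; rewrite /= cats0.
- case: T1 pT cT lT => [|//] pT cT lT _; congr Node; apply: IH; split.
  + by move=> k; case: k => // k; have := pT k.+2.
  + by move: lT => /=; lia.
  + by move=> j hj; have := cT j.+1 hj.
Qed.

Lemma path_treeP x T : encodes x T <-> T = path_tree x.
Proof. by split=> [/encodes_inj | ->] //; exact: path_tree_encodes. Qed.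

Lemma path_tree_surj T :
  is_path_tree T -> 2 <= nleaves T -> exists x, T = path_tree x.
Proof.
elim: T => [|T1 IH1 T2 IH2] //= pT _.
case: T1 T2 IH1 IH2 pT => [|A B] [|C D] IH1 IH2 pT.
- by exists [::].
- case: IH2 => [[|k] //||x ->]; last by exists (Rgt :: x).
    by have := pT k.+2.
  by have := nleaves_gt0 C; have := nleaves_gt0 D; rewrite /=; lia.
- case: IH1 => [[|k] //||x ->]; last by exists (Lft :: x).
    by have := pT k.+2; rewrite /= cats0.
  by have := nleaves_gt0 A; have := nleaves_gt0 B; rewrite /=; lia.
- by have := pT 2.
Qed.

(* [traject flip d m] is the alternating word of length m starting with d;
   both trees are meaningful only for n >= 2. *)
Definition LeftCrookedTree (n : nat) : bintree :=
  path_tree (traject flip Lft (n - 2)).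

Definition RightCrookedTree (n : nat) : bintree :=
  path_tree (traject flip Rgt (n - 2)).

(* Main.v *)
(* Three letters are pairwise distinct iff they are the three nonzero elements
   of the Klein four-group, i.e. iff they sum to 0 there; so if both trees parse
   a word u with the same root label c, then x u y is parsed by the two next
   larger trees iff x = y <> c, and the new root label is again c.  Peeling such
   pairs of equal letters leaves a word of length 2 or 3 which is pq or pcp up to
   renaming, with root label c.  After normalizing c to 2 and p to 0, each
   remaining layer is a free choice between the letters 0 and 1. *)
Require Import Defs.
From mathcomp Require Import all_boot perm zify.
From mathcomp Require Import boolp.

Set Implicit Arguments.
Unset Strict Implicit.
Unset Printing Implicit Defensive.

(** * The three letters and the production rule, up to renaming *)

Definition l0 : letter := @Ordinal 3 0 isT.
Definition l1 : letter := @Ordinal 3 1 isT.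
Definition l2 : letter := @Ordinal 3 2 isT.

Lemma letterP (P : letter -> Prop) : P l0 -> P l1 -> P l2 -> forall a, P a.
Proof.
move=> P0 P1 P2 [[|[|[|m]]] lt_m3] //.
- by have -> : Ordinal lt_m3 = l0 by apply: val_inj.
- by have -> : Ordinal lt_m3 = l1 by apply: val_inj.
- by have -> : Ordinal lt_m3 = l2 by apply: val_inj.
Qed.

Lemma rule_perm (s : {perm letter}) a b c : rule (s a) (s b) (s c) = rule a b c.
Proof. by rewrite !ruleE /= !inE !(inj_eq perm_inj). Qed.

(** This supplies the renaming that turns the root label into [l2] and the first letter into
    [l0]. *)
Lemma rule_perm_exists c p q : rule c p q ->
  exists s : {perm letter}, [/\ s l0 = p, s l1 = q & s l2 = c].
Proof.
move=> cpq; pose f (i : letter) := nth c [:: p; q; c] i.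
have f_uniq : uniq [:: p; q; c] by rewrite -(rot_uniq 2) -ruleE.
have inj_f : injective f.
  by move=> i j /eqP; rewrite /f nth_uniq // => /eqP/val_inj.
by exists (perm inj_f); split; rewrite permE.
Qed.

(** Here [a] and [b] are the outer root labels in the left and right crooked trees, [c] is the
    common inner one, and [x], [y] are the new end letters. In the Klein group [a] and [b] both
    equal [x + c + y]; since [x] and [y] differ from [c], having [x != y] would make this sum
    zero. *)
Lemma rule_layer c x y a1 a b1 b :
    rule a1 x c -> rule a a1 y -> rule b1 c y -> rule b x b1 ->
  [/\ x != c, y = x, a = c & b = c].
Proof.
elim/letterP: c; elim/letterP: x; elim/letterP: a1 => // _;
  elim/letterP: y; elim/letterP: a => // _;
  elim/letterP: b1 => // _; elim/letterP: b => // _; by split.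
Qed.

(** * Parsing with a prescribed root label, so that layers can be glued *)

Definition parses_from (T : bintree) (a : letter) (w : seq letter) : Prop :=
  exists t, [/\ Defs.shape t = T, yield t = w, valid t & root_label t = a].

Lemma parsesE T w : parses T w <-> exists a, parses_from T a w.
Proof.
split=> [[t [? ? ?]]|[a [t [? ? ? ?]]]]; last by exists t.
by exists (root_label t), t.
Qed.

Lemma parses_from_Leaf a w : parses_from Leaf a w <-> w = [:: a].
Proof.
split=> [[[b|b t1 t2] [//= _ <- _ ->]]|->] //.
by exists (LLeaf a).
Qed.

Lemma parses_from_Node T1 T2 a w :
  parses_from (Node T1 T2) a w <->
  exists b c u v, [/\ w = u ++ v, rule a b c,
                      parses_from T1 b u & parses_from T2 c v].
Proof.
split=> [[[a'|a' t1 t2] [//= [<- <-] <- /and3P[r v1 v2] <-]]|].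
  exists (root_label t1), (root_label t2), (yield t1), (yield t2).
  by split=> //; [exists t1 | exists t2].
move=> [b [c [u [v [-> r [t1 [<- <- v1 e1]] [t2 [<- <- v2 e2]]]]]]].
by exists (LNode a t1 t2); split=> //=; rewrite e1 e2 r v1.
Qed.

Lemma parses_from_NodeL T a w :
  parses_from (Node T Leaf) a w <->
  exists b u y, [/\ w = rcons u y, rule a b y & parses_from T b u].
Proof.
rewrite parses_from_Node; split=> [[b [c [u [v [-> r Tu /parses_from_Leaf->]]]]]|].
  by exists b, u, c; rewrite cats1.
move=> [b [u [y [-> r Tu]]]]; exists b, y, u, [:: y].
by rewrite cats1; split=> //; apply/parses_from_Leaf.
Qed.

Lemma parses_from_NodeR T a w :
  parses_from (Node Leaf T) a w <->
  exists b x u, [/\ w = x :: u, rule a x b & parses_from T b u].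
Proof.
rewrite parses_from_Node; split=> [[b [c [u [v [-> r /parses_from_Leaf-> Tv]]]]]|].
  by exists c, b, v.
move=> [b [x [u [-> r Tu]]]]; exists x, b, [:: x], u.
by split=> //; apply/parses_from_Leaf.
Qed.

(** The index [m] is the number of leaves minus two, which keeps truncated subtraction out of the
    inductions. *)
Definition crooked (d : dir) (m : nat) : bintree := path_tree (traject flip d m).

(** Two flips restore the direction: the two outer levels add one leaf at each end and enclose a
    crooked tree of the same kind. *)
Lemma crookedL_SS m c w :
  parses_from (crooked Lft m.+2) c w <->
  exists x u y a a', [/\ w = x :: rcons u y, rule c a' y, rule a' x a
                       & parses_from (crooked Lft m) a u].
Proof.
rewrite [crooked _ _]/= parses_from_NodeL; split.
  move=> [a' [v [y [-> r /parses_from_NodeR[a [x [u [-> r' Tu]]]]]]]].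
  by exists x, u, y, a, a'.
move=> [x [u [y [a [a' [-> r r' Tu]]]]]]; exists a', (x :: u), y; split=> //.
by apply/parses_from_NodeR; exists a, x, u.
Qed.

Lemma crookedR_SS m c w :
  parses_from (crooked Rgt m.+2) c w <->
  exists x u y a a', [/\ w = x :: rcons u y, rule c x a', rule a' a y
                       & parses_from (crooked Rgt m) a u].
Proof.
rewrite [crooked _ _]/= parses_from_NodeR; split.
  move=> [a' [x [v [-> r /parses_from_NodeL[a [u [y [-> r' Tu]]]]]]]].
  by exists x, u, y, a, a'.
move=> [x [u [y [a [a' [-> r r' Tu]]]]]]; exists a', x, (rcons u y); split=> //.
by apply/parses_from_NodeL; exists a, u, y.
Qed.

Lemma crooked0 d c w :
  parses_from (crooked d 0) c w <-> exists x y, w = [:: x; y] /\ rule c x y.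
Proof.
rewrite [crooked _ _]/= parses_from_NodeR; split.
  by move=> [y [x [u [-> r /parses_from_Leaf->]]]]; exists x, y.
by move=> [x [y [-> r]]]; exists y, x, [:: y]; split=> //; apply/parses_from_Leaf.
Qed.

Lemma crookedL1 c w :
  parses_from (crooked Lft 1) c w <->
  exists x z y a, [/\ w = [:: x; z; y], rule c a y & rule a x z].
Proof.
rewrite [crooked _ _]/= parses_from_NodeL; split.
  move=> [a [v [y [-> r /(crooked0 Lft)[x [z [-> r']]]]]]].
  by exists x, z, y, a.
move=> [x [z [y [a [-> r r']]]]]; exists a, [:: x; z], y; split=> //.
by apply/(crooked0 Lft); exists x, z.
Qed.

Lemma crookedR1 c w :
  parses_from (crooked Rgt 1) c w <->
  exists x z y a, [/\ w = [:: x; z; y], rule c x a & rule a z y].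
Proof.
rewrite [crooked _ _]/= parses_from_NodeR; split.
  move=> [a [x [v [-> r /(crooked0 Lft)[z [y [-> r']]]]]]].
  by exists x, z, y, a.
move=> [x [z [y [a [-> r r']]]]]; exists a, x, [:: z; y]; split=> //.
by apply/(crooked0 Lft); exists z, y.
Qed.

(** * Canonical words and the words parsed by both trees *)

Definition layer (b : bool) : letter := if b then l1 else l0.

(* [o] is the parity of the length of the word; the root label is always [l2]. *)
Fixpoint canon (o : bool) (bs : seq bool) : seq letter :=
  if bs is b :: bs' then layer b :: rcons (canon o bs') (layer b)
  else if o then [:: l0; l2; l0] else [:: l0; l1].

Lemma size_canon o bs : size (canon o bs) = (size bs).*2 + o + 2.
Proof.
elim: bs => [|b bs IH] /=; first by case: o.
by rewrite size_rcons IH.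
Qed.

Lemma crooked_canon (s : {perm letter}) (o : bool) bs d :
  parses_from (crooked d ((size bs).*2 + o)) (s l2) (map s (canon o bs)).
Proof.
elim: bs => [|b bs IH].
  case: o; case: d => /=.
  - apply/crookedL1; exists (s l0), (s l2), (s l0), (s l1).
    by rewrite !rule_perm.
  - apply/crookedR1; exists (s l0), (s l2), (s l0), (s l1).
    by rewrite !rule_perm.
  - by apply/crooked0; exists (s l0), (s l1); rewrite rule_perm.
  - by apply/crooked0; exists (s l0), (s l1); rewrite rule_perm.
rewrite [size _]/= doubleS !addSn /= map_rcons; case: d IH => IH.
  apply/crookedL_SS; exists (s (layer b)), (map s (canon o bs)), (s (layer b)).
  (* The label between the two roots must be the third letter, besides [l2] and [layer b]. *)
  by exists (s l2), (s (layer (~~ b))); rewrite !rule_perm; split=> //; case: (b).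
apply/crookedR_SS; exists (s (layer b)), (map s (canon o bs)), (s (layer b)).
by exists (s l2), (s (layer (~~ b))); rewrite !rule_perm; split=> //; case: (b).
Qed.

Lemma layer_exists (s : {perm letter}) x :
  x != s l2 -> exists b, x = s (layer b).
Proof.
rewrite -{1 2}(permKV s x) (inj_eq perm_inj).
elim/letterP: (s^-1%g x) => // _; first by exists false.
by exists true.
Qed.

(** Agreement of the two root labels is part of the conclusion because the next layer needs a common
    inner label. *)
Lemma crooked_both k (o : bool) w c d :
    parses_from (crooked Lft (k.*2 + o)) c w ->
    parses_from (crooked Rgt (k.*2 + o)) d w ->
  exists (s : {perm letter}) bs,
    [/\ size bs = k, w = map s (canon o bs), c = s l2 & d = s l2].
Proof.
elim: k w c d => [|k IH] w c d.
  case: o => /=.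
    move=> /crookedL1[x [z [y [a [-> r1 r2]]]]].
    move=> /crookedR1[_ [_ [_ [b [[<- <- <-] r3 r4]]]]].
    (* A three-leaf tree is one layer around a single leaf, so the middle letter [z] acts as the
       common inner root label. *)
    have [x_z e1 e2 e3] := rule_layer r2 r1 r4 r3.
    have [s [s0 s1 s2]] : exists s : {perm letter},
        [/\ s l0 = x, s l1 = a & s l2 = z].
      by apply: rule_perm_exists; move: r2; rewrite !ruleE -rev_uniq.
    by exists s, [::]; rewrite /= s0 s2 e1 e2 e3.
  move=> /crooked0[x [y [-> r1]]] /crooked0[_ [_ [[<- <-] r2]]].
  have [s [s0 s1 s2]] := rule_perm_exists r1.
  exists s, [::]; rewrite /= s0 s1 s2; split=> //.
  (* Distinct [x] and [y] leave a single root label, whence [d = c]. *)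
  move: r1 r2; elim/letterP: c {s2}; elim/letterP: x {s0} => //;
    elim/letterP: y {s1} => // _; by elim/letterP: d.
rewrite doubleS !addSn => /crookedL_SS[x [u [y [a [a1 [-> r1 r2 Lu]]]]]].
move=> /crookedR_SS[x' [u' [y' [b [b1 [[<-]]]]]]].
move=> /rcons_inj[<- <-] r3 r4 Ru.
have [s [bs [sz_bs e ea eb]]] := IH _ _ _ Lu Ru.
rewrite eb -ea in r4.
have [x_a -> -> ->] := rule_layer r2 r1 r4 r3.
rewrite ea in x_a *; have [i ->] := layer_exists x_a.
by exists s, (i :: bs); rewrite /= map_rcons e sz_bs.
Qed.

(** The innermost word pins down [s]; only then can the layers around it be compared. Hence no class
    contains two canonical words of the same length. *)
Lemma canon_inj (s : {perm letter}) o bs bs' : size bs = size bs' ->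
  canon o bs = map s (canon o bs') -> [/\ s l0 = l0, s l1 = l1 & bs = bs'].
Proof.
elim: bs bs' => [|b bs IH] [|b' bs'] //= => [_|[sz_bs] [e]].
  case: o => /= -[s0 s2]; split=> //.
  (* The odd core shows only [l0] and [l2]; injectivity of [s] settles [s l1]. *)
  have := inj_eq (@perm_inj _ s) l1 l0; have := inj_eq (@perm_inj _ s) l1 l2.
  by rewrite -s0 -s2; elim/letterP: (s l1).
rewrite map_rcons => /rcons_inj[/(IH _ sz_bs)[s0 s1 ->] _]; split=> //.
by move: e; case: b; case: b'; rewrite /= ?s0 ?s1.
Qed.

(** * Counting classes under renaming *)

Lemma word_class_map n (s : {perm letter}) (w : n.-tuple letter) :
  word_class (map_tuple s w) = word_class w.
Proof.
apply/setP => v; apply/imsetP/imsetP => -[t _ ->].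
  exists (s * t)%g => //; apply: val_inj; rewrite /= -map_comp.
  by apply: eq_map => i /=; rewrite permM.
exists (s^-1 * t)%g => //; apply: val_inj; rewrite /= -map_comp.
by apply: eq_map => i /=; rewrite permM permK.
Qed.

(** Taking the class of the canonical word is a bijection from boolean [k]-tuples: [canon_inj] gives
    injectivity, [crooked_both] surjectivity. *)
Lemma card_crooked_ParseWords k (o : bool) :
  #|ParseWords (k.*2 + o + 2) (crooked Lft (k.*2 + o)) (crooked Rgt (k.*2 + o))|
  = 2 ^ k.
Proof.
have sz_canon (bs : k.-tuple bool) : size (canon o bs) == k.*2 + o + 2.
  by rewrite size_canon size_tuple.
pose F (bs : k.-tuple bool) := word_class (Tuple (sz_canon bs)).
have inj_F : injective F.
  move=> bs bs' eF.
  have : Tuple (sz_canon bs) \in F bs'.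
    rewrite -eF; apply/imsetP; exists 1%g => //; apply: val_inj => /=.
    by rewrite (eq_map (perm1 (T := _))) map_id.
  case/imsetP=> s _ /(congr1 val) /= e.
  have sz_eq : size bs = size bs' by rewrite !size_tuple.
  by have [_ _ /val_inj] := canon_inj sz_eq e.
have -> : ParseWords (k.*2 + o + 2) (crooked Lft (k.*2 + o))
    (crooked Rgt (k.*2 + o)) = F @: setT.
  apply/setP => C; apply/imsetP/imsetP => -[].
    move=> w; rewrite inE => /asboolP[/parsesE[c Lw] /parsesE[d Rw]] ->.
    have [s [bs [sz_bs e _ _]]] := crooked_both Lw Rw.
    move/eqP: sz_bs => sz_bs; exists (Tuple sz_bs) => //.
    by rewrite /F -[RHS](word_class_map s); congr word_class; apply: val_inj.
  move=> bs _ ->; exists (Tuple (sz_canon bs)) => //.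
  have parses_canon d : parses (crooked d (k.*2 + o)) (canon o bs).
    apply/parsesE; exists l2; have := crooked_canon 1 o bs d.
    by rewrite size_tuple perm1 (eq_map (perm1 (T := _))) map_id.
  by rewrite inE; apply/asboolP.
by rewrite card_imset // cardsT card_tuple card_bool.
Qed.

Theorem theorem8 (n : nat) (hn : 2 <= n) :
  #|ParseWords n (LeftCrookedTree n) (RightCrookedTree n)| = 2 ^ (n %/ 2 - 1).
Proof.
(* The half of [n - 2] counts the layers and its parity selects the core. *)
have := card_crooked_ParseWords (n - 2)./2 (odd (n - 2)).
rewrite [_.*2 + _]addnC odd_double_half subnK //.
by have -> : (n - 2)./2 = n %/ 2 - 1 by lia.
Qed.
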